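(* Let $f$ be a real homogeneous polynomial of degree $n$ in the two variables $(x^1,x^2)$ and let $P\subset\mathbb{R}^3$ be its graph $x^3=f(x^1,x^2)$. Then $P$ has a finite, even number of umbilic points at infinity (that is, the set of $A\in[0,2\pi)$ at which $P$ has an umbilic at infinity is finite and has an even number of elements), and this number is no more than $6n-8$.
   Context: Write $z=x^1+ix^2$ for the complex coordinate on the domain $\mathbb{R}^2$, and let $\kappa_1,\kappa_2$ be the principal curvatures of $P$, regarded as functions of $z$ (at the point of $P$ lying over $z$). Gauss map. Let $\xi$ be the holomorphic (stereographic) coordinate about the North pole of $\mathbb{S}^2$, for which the unit vector corresponding to $\xi$ has components $\frac{2\xi}{1+\xi\bar\xi}\in\mathbb{C}\cong\mathbb{R}^2$ and $\frac{1-\xi\bar\xi}{1+\xi\bar\xi}\in\mathbb{R}$. The upward unit normal of $P$ at the point over $z$ has coordinate $\xi=\xi(z,\bar z)$ with $|\xi|<1$ and $\frac{\xi}{1-\xi\bar\xi}=-\partial_{\bar z}f$. Distance to infinity. $d_\infty=1-|\xi|$, a positive function on $P$. Umbilic at infinity. $P$ has an umbilic at infinity at $A\in[0,2\pi)$ if $\lim_{R\to\infty}\left.\frac{|\kappa_1-\kappa_2|}{d_\infty}\right|_{z=Re^{iA}}=0$ (the limit exists and equals $0$).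
   Formalization: The formal theorem additionally assumes that f is not of the form c(ax^1+bx^2)^n (which excludes f=0 and n≤1); for every such f the claim fails, since infinitely many A are umbilic at infinity, e.g. f=(x^1)^2. *)

(* Defs.v *)
From HB Require Import structures.
From mathcomp Require Import all_boot all_order all_algebra.
From mathcomp Require Import all_classical all_reals all_analysis.
From mathcomp Require Import complex.
(* The notations of mpoly clash with those of analysis. *)
From mathcomp Require Import -(notations) mpoly.
From mathcomp Require Import ring lra.

Set Implicit Arguments.
Unset Strict Implicit.
Unset Printing Implicit Defensive.

Import Order.TTheory GRing.Theory Num.Theory.
Import numFieldNormedType.Exports.

Local Open Scope classical_set_scope.
Local Open Scope ring_scope.

Section Graph.
Context {R : realType}.
Implicit Types (f : 'rV[R]_2 -> R) (x : 'rV[R]_2) (k : R) (xi : R[i]).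

Definition poly_fun (p : mpoly 2 R) : 'rV[R]_2 -> R :=
  fun x => meval (fun i => x 0 i) p.

Definition partial f (i : 'I_2) : 'rV[R]_2 -> R :=
  fun x => 'D_(delta_mx 0 i) f x.

Definition grad f x : 'rV[R]_2 := \row_i partial f i x.

Definition hess f x : 'M[R]_2 := \matrix_(i, j) partial (partial f j) i x.

Definition area_density f x : R :=
  Num.sqrt (1 + partial f 0 x ^+ 2 + partial f 1 x ^+ 2).

(* Components in C and R of the upward unit normal of the graph of f, the   *)
(* horizontal R^2 being identified with C.                                  *)
Definition normal_hor f x : R[i] :=
  (- partial f 0 x / area_density f x +i* (- partial f 1 x / area_density f x))%C.
Definition normal_ver f x : R := (area_density f x)^-1.

(* Fundamental forms of the graph of f in the coordinates (x^1, x^2), the   *)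
(* second one with respect to the upward normal.                            *)
Definition first_form f x : 'M[R]_2 := 1%:M + (grad f x)^T *m grad f x.
Definition second_form f x : 'M[R]_2 := (area_density f x)^-1 *: hess f x.

Definition shape_operator f x : 'M[R]_2 :=
  invmx (first_form f x) *m second_form f x.

(* k1 and k2 are the eigenvalues of the shape operator, with multiplicity.  *)
Definition principal_curvatures f x k1 k2 : Prop :=
  char_poly (shape_operator f x) = ('X - k1%:P) * ('X - k2%:P).

(* xi is the stereographic coordinate of the upward unit normal.            *)
Definition gauss_coordinate f x xi : Prop :=
  2 * xi / (1 + xi * xi^*) = normal_hor f x /\
  (1 - xi * xi^*) / (1 + xi * xi^*) = (normal_ver f x)%:C%C.

Definition dzbar f x : R[i] := (partial f 0 x +i* partial f 1 x)%C / 2.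

Definition dist_infty xi : R := 1 - ComplexField.Normc.normc xi.

Definition polar (r A : R) : 'rV[R]_2 :=
  \row_i if i == 0 then r * cos A else r * sin A.

Definition umbilic_at_infinity (k1 k2 : 'rV[R]_2 -> R) (xi : 'rV[R]_2 -> R[i])
    (A : R) : Prop :=
  `|k1 (polar r A) - k2 (polar r A)| / dist_infty (xi (polar r A))
    @[r --> +oo] --> 0.

(* The degenerate forms c * (a x^1 + b x^2)^n, which include every form of  *)
(* degree n <= 1 and the zero form. These are the forms with identically    *)
(* vanishing Hessian determinant (their graphs are planes or cylinders),    *)
(* and exactly those for which infinitely many directions are umbilic: for  *)
(* f = (x^1)^2, all directions except +-pi/2.                               *)
Definition power_of_linear_form (n : nat) f : Prop :=
  exists c a b : R, forall x, f x = c * (a * x 0 0 + b * x 0 1) ^+ n.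

Let good (i : 'I_2) (p : mpoly 2 R) := forall x,
  is_derive x (delta_mx 0 i) (poly_fun p) (poly_fun (mderiv i p) x).

Let good_XU i j : good i (mpolyX R (mnm1 j)).
Proof.
move=> x.
rewrite mderivX /poly_fun mevalZ.
have -> : (fun x0 : 'rV[R]_2 => meval (fun i0 => x0 0 i0) (mpolyX R (mnm1 j))) = (fun x0 => x0 0 j).
  by apply/funext => y; rewrite mevalXU.
have -> : ((mnm1 j i)%:R * meval [eta x 0] (mpolyX R (mnm_sub (mnm1 j) (mnm1 i))))
   = (delta_mx 0 i : 'rV[R]_2) 0 j.
  rewrite mnm1E mxE eqxx /=; case: eqVneq => [->|_]; last by rewrite mul0r.
  have -> : mnm_sub (mnm1 i) (mnm1 i) = mnm0. apply/mnmP => l; rewrite mnmBE subnn mnmE. done.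
  by rewrite mevalX big1 ?mulr1 // => l _; rewrite mnmE expr0.
have lin : linear (fun x0 : 'rV[R]_2 => x0 0 j : R) by move=> a u v; rewrite !mxE.
pose h := GRing.isLinear.Build _ _ _ _ _ lin.
pose g : {linear 'rV[R]_2 -> R} := HB.pack (fun x0 : 'rV[R]_2 => x0 0 j : R) h.
have D : differentiable g x by apply: differentiable_coord.
apply: DeriveDef; first exact: (diff_derivable D).
rewrite (deriveE _ D) diff_lin //.
exact: coord_continuous.
Qed.

Let good_C i c : good i (mpolyC 2 c).
Proof.
move=> x; rewrite mderivC.
have -> : poly_fun (mpolyC 2 c) = cst c by apply/funext => y; rewrite /poly_fun mevalC.
by rewrite /poly_fun meval0; exact: is_derive_cst.
Qed.

Let poly_funD (p q : mpoly 2 R) : poly_fun (p + q) = poly_fun p + poly_fun q.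
Proof. by apply/funext => y; rewrite /poly_fun mevalD. Qed.

Let poly_funM (p q : mpoly 2 R) : poly_fun (p * q) = poly_fun p * poly_fun q.
Proof. by apply/funext => y; rewrite /poly_fun mevalM. Qed.

Let good_D i p q : good i p -> good i q -> good i (p + q).
Proof.
by move=> hp hq x; rewrite mderivD !poly_funD; apply: is_deriveD; [exact: hp | exact: hq].
Qed.

Let good_M i p q : good i p -> good i q -> good i (p * q).
Proof.
move=> hp hq x; rewrite mderivM poly_funD !poly_funM.
apply: is_derive_eq (is_deriveM (hp x) (hq x)) _.
by rewrite /GRing.scale /= addrC [poly_fun q x * _]mulrC.
Qed.

Lemma is_derive_poly_fun (p : mpoly 2 R) i x :
  is_derive x (delta_mx 0 i) (poly_fun p) (poly_fun (mderiv i p) x).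
Proof.
suff: good i p by exact.
elim/mpolyind: p => [|c m p _ _ ih]; first by rewrite -(mpolyC0 2); exact: good_C.
apply: good_D => //; rewrite -mul_mpolyC; apply: good_M; first exact: good_C.
rewrite mpolyXE_id.
elim/big_ind: _ => [||j _].
- rewrite -(mpolyC1 2 R); exact: good_C.
- by move=> u v; exact: good_M.
elim: (m j) => [|l ihl]; first by rewrite expr0 -(mpolyC1 2 R); exact: good_C.
by rewrite exprS; apply: good_M => //; exact: good_XU.
Qed.

Lemma partial_poly_fun (p : mpoly 2 R) i : partial (poly_fun p) i = poly_fun (mderiv i p).
Proof.
by apply/funext => x; apply: derive_val; exact: is_derive_poly_fun.
Qed.

Let Cdiv (a b c : R) : ((a +i* b) / c%:C)%C = (a / c +i* (b / c))%C.
Proof.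
rewrite -fmorphV /=; apply/eqP; rewrite eq_complex /=; apply/andP; split; apply/eqP; ring.
Qed.

Let Cnorm (a b : R) : (a +i* b)%C * (a +i* b)%C^* = (a ^+ 2 + b ^+ 2)%:C%C.
Proof.
by apply/eqP; rewrite eq_complex /=; apply/andP; split; apply/eqP; ring.
Qed.

Let hform (a b : R) : 2 * (a +i* b)%C / (1 + (a +i* b)%C * (a +i* b)%C^*) =
  (2 * a / (1 + (a ^+ 2 + b ^+ 2)) +i* (2 * b / (1 + (a ^+ 2 + b ^+ 2))))%C.
Proof.
rewrite Cnorm.
have -> : 1 + (a ^+ 2 + b ^+ 2)%:C%C = (1 + (a ^+ 2 + b ^+ 2))%:C%C :> R[i] by rewrite [in RHS]rmorphD rmorph1.
have -> : 2 * (a +i* b)%C = (2 * a +i* (2 * b))%C :> R[i].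
  have -> : (2 : R[i]) = 1 + 1 by [].
  by rewrite mulrDl mul1r; apply/eqP; rewrite eq_complex /=; apply/andP; split; apply/eqP; ring.
by rewrite Cdiv.
Qed.

Let eqC (a b c d : R) : (a +i* b)%C = (c +i* d)%C <-> a = c /\ b = d.
Proof. by split => [[-> ->] //|[-> ->]]. Qed.

Let vform (a b : R) : (1 - (a +i* b)%C * (a +i* b)%C^*) / (1 + (a +i* b)%C * (a +i* b)%C^*) =
  ((1 - (a ^+ 2 + b ^+ 2)) / (1 + (a ^+ 2 + b ^+ 2)))%:C%C.
Proof. by rewrite Cnorm !(rmorphB, rmorphD, rmorphM, fmorphV, rmorph1). Qed.

Let gaussE f x (a b : R) : let s := a ^+ 2 + b ^+ 2 in let W := area_density f x in
  gauss_coordinate f x (a +i* b)%C <->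
  [/\ 2 * a / (1 + s) = - partial f 0 x / W, 2 * b / (1 + s) = - partial f 1 x / W
    & (1 - s) / (1 + s) = W^-1].
Proof.
move=> s W; rewrite /gauss_coordinate hform vform /normal_hor /normal_ver eqC eqC.
by split => [[[-> ->] [->]]//|[-> -> ->]].
Qed.

Let dens f x : let W := area_density f x in
  [/\ 0 < W, 1 <= W & W ^+ 2 = 1 + partial f 0 x ^+ 2 + partial f 1 x ^+ 2].
Proof.
have := sqr_ge0 (partial f 0 x); have := sqr_ge0 (partial f 1 x) => h1 h0.
rewrite /area_density /=.
rewrite sqr_sqrtr; last by lra.
rewrite sqrtr_gt0 -[X in X <= _]sqrtr1 ler_sqrt; last by lra.
by split => //; lra.
Qed.

Lemma exists_gauss_coordinate f x : exists xi, gauss_coordinate f x xi.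
Proof.
have [W0 W1 W2] := dens f x.
set W := area_density f x in W0 W1 W2.
exists (- partial f 0 x / (1 + W) +i* (- partial f 1 x / (1 + W)))%C.
apply/gaussE; rewrite -/W.
have W10 : 1 + W != 0 by rewrite gt_eqF //; lra.
have Wn0 : W != 0 by rewrite gt_eqF.
set s := (- partial f 0 x / (1 + W)) ^+ 2 + (- partial f 1 x / (1 + W)) ^+ 2.
have sE : s = (W - 1) / (1 + W).
  have -> : s = (partial f 0 x ^+ 2 + partial f 1 x ^+ 2) / (1 + W) ^+ 2.
    by rewrite /s; field.
  have -> : partial f 0 x ^+ 2 + partial f 1 x ^+ 2 = W ^+ 2 - 1 by rewrite W2; ring.
  by field.
have s1 : 1 + s = 2 * W / (1 + W) by rewrite sE; field.
have s2 : 1 - s = 2 / (1 + W) by rewrite sE; field.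
rewrite s1 s2.
by split; field; rewrite W10 Wn0.
Qed.


Lemma gauss_coordinateP f x xi : gauss_coordinate f x xi <->
  ComplexField.Normc.normc xi < 1 /\ xi / (1 - xi * xi^*) = - dzbar f x.
Proof.
case: xi => a b; rewrite gaussE.
have [W0 W1 W2] := dens f x.
set W := area_density f x in W0 W1 W2 *.
set s := a ^+ 2 + b ^+ 2.
have s0 : 0 <= s by rewrite /s; have := sqr_ge0 a; have := sqr_ge0 b; lra.
have nE : (ComplexField.Normc.normc (a +i* b)%C < 1) = (s < 1).
  by rewrite /= -/s -[X in _ < X]sqrtr1 ltr_sqrt.
have dE : (a +i* b)%C / (1 - (a +i* b)%C * (a +i* b)%C^*) = - dzbar f x <->
   a / (1 - s) = - partial f 0 x / 2 /\ b / (1 - s) = - partial f 1 x / 2.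
  rewrite Cnorm -/s.
  have -> : 1 - s%:C%C = (1 - s)%:C%C :> R[i] by rewrite rmorphB rmorph1.
  rewrite Cdiv /dzbar.
  have -> : (2 : R[i]) = 2%:C%C by rewrite rmorph_nat.
  by rewrite Cdiv [- _]/GRing.opp /= eqC !mulNr.
rewrite nE dE.
have s1 : 1 + s != 0 by rewrite gt_eqF //; lra.
have Wn0 : W != 0 by rewrite gt_eqF.
split => [[h0 h1 h2]|[h0 [h1 h2]]].
  have s2 : 1 - s = (1 + s) / W by rewrite -h2; field.
  have s3 : 0 < 1 - s by rewrite s2 divr_gt0 //; lra.
  have s4 : 1 - s != 0 by rewrite gt_eqF.
  split; first by lra.
  have -> : - partial f 0 x = 2 * a / (1 + s) * W by rewrite h0; field.
  have -> : - partial f 1 x = 2 * b / (1 + s) * W by rewrite h1; field.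
  have -> : W = (1 + s) / (1 - s) by rewrite s2; field; rewrite s1 Wn0.
  by split; field; rewrite s1 s4.
have s4 : 1 - s != 0 by rewrite gt_eqF //; lra.
have p0 : partial f 0 x = - (2 * (a / (1 - s))) by rewrite h1; field.
have p1 : partial f 1 x = - (2 * (b / (1 - s))) by rewrite h2; field.
have WE : W = (1 + s) / (1 - s).
  apply/eqP; rewrite -(@eqrXn2 _ 2) ?W2 //; last 2 first.
  - exact: ltW.
  - by rewrite divr_ge0 //; lra.
  have -> : 1 + partial f 0 x ^+ 2 + partial f 1 x ^+ 2 = 1 + 4 * s / (1 - s) ^+ 2.
    by rewrite p0 p1 /s; field; exact: s4.
  by apply/eqP; field.
rewrite WE p0 p1; split; field; rewrite ?s1 ?s4 //.
Qed.


Let det2 (T : comNzRingType) (A : 'M[T]_2) :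
  \det A = A 0 0 * A 1 1 - A 0 1 * A 1 0.
Proof.
rewrite (expand_det_row _ 0) !big_ord_recl big_ord0 /cofactor !det_mx11 !mxE /=.
have -> : lift 0 0 = 1 :> 'I_2 by exact/val_inj.
have -> : lift 1 0 = 0 :> 'I_2 by exact/val_inj.
by rewrite /= !(expr0, expr1); ring.
Qed.

Let sum2E (F : 'I_2 -> R) : \sum_i F i = F 0 + F 1.
Proof. by rewrite !big_ord_recl big_ord0 addr0; congr (_ + F _); exact/val_inj. Qed.

Let char_poly2 (A : 'M[R]_2) k1 k2 : k1 + k2 = A 0 0 + A 1 1 ->
  k1 * k2 = A 0 0 * A 1 1 - A 0 1 * A 1 0 -> char_poly A = ('X - k1%:P) * ('X - k2%:P).
Proof.
move=> ht hd; rewrite /char_poly det2 /char_poly_mx !mxE /=.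
rewrite !mulr1n !mulr0n !sub0r.
have htP : k1%:P + k2%:P = (A 0 0)%:P + (A 1 1)%:P by rewrite -!polyCD ht.
have hdP : k1%:P * k2%:P = (A 0 0)%:P * (A 1 1)%:P - (A 0 1)%:P * (A 1 0)%:P.
  by rewrite -!polyCM -polyCB hd.
transitivity ('X ^+ 2 - (k1%:P + k2%:P) * 'X + k1%:P * k2%:P); last by ring.
by rewrite htP hdP; ring.
Qed.

Let discr_ge0 (G S H : 'M[R]_2) : G 1 0 = G 0 1 -> H 1 0 = H 0 1 ->
  0 < G 0 0 -> 0 < \det G -> G *m S = H ->
  0 <= (S 0 0 + S 1 1) ^+ 2 - 4 * (S 0 0 * S 1 1 - S 0 1 * S 1 0).
Proof.
move=> symG symH E0 D0 GS.
have e00 : G 0 0 * S 0 0 + G 0 1 * S 1 0 = H 0 0 by rewrite -GS mxE sum2E.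
have e01 : G 0 0 * S 0 1 + G 0 1 * S 1 1 = H 0 1 by rewrite -GS mxE sum2E.
have e10 : G 0 1 * S 0 0 + G 1 1 * S 1 0 = H 0 1.
  by rewrite -symH -GS mxE sum2E symG.
have e11 : G 0 1 * S 0 1 + G 1 1 * S 1 1 = H 1 1.
  by rewrite -GS mxE sum2E symG.
move: D0 E0 e00 e01 e10 e11; rewrite det2 symG -expr2.
move: (G 0 0) (G 0 1) (G 1 1) (S 0 0) (S 0 1) (S 1 0) (S 1 1) (H 0 0) (H 0 1) (H 1 1).
move=> E F K s00 s01 s10 s11 L M N D0 E0 e00 e01 e10 e11.
set t := s00 + s11; set d := s00 * s11 - _.
have tE : t * (E * K - F ^+ 2) = E * N - 2 * F * M + K * L.
  rewrite /t -e00 -e11.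
  transitivity (E * K * s00 + E * K * s11 + E * F * s01 + F * K * s10
    - F * (E * s01 + F * s11) - F * (F * s00 + K * s10)); first by ring.
  by rewrite e01 e10; ring.
have dE : d * (E * K - F ^+ 2) = L * N - M ^+ 2.
  have -> : M ^+ 2 = (E * s01 + F * s11) * (F * s00 + K * s10).
    by rewrite e01 e10.
  by rewrite /d -e00 -e11; ring.
have key : (t ^+ 2 - 4 * d) * (E * K - F ^+ 2) ^+ 2 =
    4 * (E * K - F ^+ 2) * ((E * M - F * L) / E) ^+ 2
    + (E * N - K * L - 2 * F / E * (E * M - F * L)) ^+ 2.
  transitivity ((t * (E * K - F ^+ 2)) ^+ 2
     - 4 * (d * (E * K - F ^+ 2)) * (E * K - F ^+ 2)); first by ring.
  by rewrite tE dE; field; rewrite gt_eqF.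
rewrite -(pmulr_lge0 _ (exprn_gt0 2 D0)) key.
by rewrite addr_ge0 ?sqr_ge0 // mulr_ge0 ?sqr_ge0 // mulr_ge0 ?ler0n // ltW.
Qed.

Let eigen_exists (S : 'M[R]_2) :
  0 <= (S 0 0 + S 1 1) ^+ 2 - 4 * (S 0 0 * S 1 1 - S 0 1 * S 1 0) ->
  exists k1 k2, char_poly S = ('X - k1%:P) * ('X - k2%:P).
Proof.
set t := S 0 0 + S 1 1; set d := _ - S 0 1 * _ => disc.
pose q := Num.sqrt (t ^+ 2 - 4 * d).
have q2 : q ^+ 2 = t ^+ 2 - 4 * d by rewrite sqr_sqrtr.
exists ((t + q) / 2), ((t - q) / 2); apply: char_poly2; first by rewrite -/t; field.
rewrite -/d; have -> : d = (t ^+ 2 - q ^+ 2) / 4 by rewrite q2; field.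
by field.
Qed.

Lemma exists_principal_curvatures (p : mpoly 2 R) x :
  exists k1 k2, principal_curvatures (poly_fun p) x k1 k2.
Proof.
set f := poly_fun p; apply: eigen_exists.
have [W0 _ W2] := dens f x.
have D : \det (first_form f x) = area_density f x ^+ 2.
  by rewrite det2 !mxE !big_ord1 !mxE /= W2; ring.
apply: (@discr_ge0 (first_form f x) _ (second_form f x)).
- by rewrite !mxE !big_ord1 !mxE mulrC.
- by rewrite !mxE /f !partial_poly_fun mderiv_comm.
- rewrite !mxE !big_ord1 !mxE /= -expr2.
  by rewrite ltr_wpDr ?sqr_ge0 // ltr01.
- by rewrite D exprn_gt0.
- by rewrite mulKVmx // unitmxE D unitfE expf_neq0 // gt_eqF.
Qed.

End Graph.

(* Main.v *)
Require Import Defs.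
From HB Require Import structures.
From mathcomp Require Import all_boot all_order all_algebra.
From mathcomp Require Import all_classical all_reals all_analysis.
From mathcomp Require Import complex.
From mathcomp Require Import -(notations) mpoly.
From mathcomp Require Import finmap zify ring lra.
Import Order.TTheory GRing.Theory Num.Theory.
Import numFieldNormedType.Exports.
Local Open Scope classical_set_scope.
Local Open Scope card_scope.
Local Open Scope ring_scope.

(* With W the area density, W * d_oo lies in [1/2, 1], so |k1 - k2| / d_oo tends to 0 exactly
   when W^2 (k1 - k2)^2 does. For a form F of degree n with gradient (a, b) and second
   derivatives L, M, N at u = (cos A, sin A), homogeneity shows that this happens iff
   q = b^2 L - 2 a b M + a^2 N vanishes at u and, when a = b = 0, also L + N = 0. Euler's
   identity gives (n - 1) q = n F D with D = L N - M^2 the Hessian determinant, a form of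
   degree 3 n - 4 in all. If F D = 0 identically, then P = F(X, 1) satisfies
   n P P'' = (n - 1) P'^2, so P' and n P - X P' have zero Wronskian and F is a multiple of a
   power of a linear form. Otherwise F D has at most 3 n - 4 zeros in [0, pi), and the
   umbilic directions are invariant under A -> A + pi. *)

(** * Binary forms: Euler's identity, dehomogenization, the Hessian *)

Section BinaryForms.
Context {R : realType}.
Implicit Types (p q : mpoly 2 R) (x : 'rV[R]_2) (n d : nat).

Lemma sum_ord2 (V : nmodType) (F : 'I_2 -> V) : \sum_i F i = F 0 + F 1.
Proof. by rewrite !big_ord_recl big_ord0 addr0; congr (_ + F _); exact/val_inj. Qed.

Lemma prod_ord2 (S : pzSemiRingType) (F : 'I_2 -> S) : \prod_i F i = F 0 * F 1.
Proof. by rewrite !big_ord_recl big_ord0 mulr1; congr (_ * F _); exact/val_inj. Qed.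

Lemma mdeg_ord2 (m : multinom 2) : mdeg m = (m 0%R + m 1%R)%N.
Proof. by rewrite mdegE !big_ord_recl big_ord0 addn0; congr (_ + m _)%N; exact/val_inj. Qed.

Lemma dhomog_ind n (P : mpoly 2 R -> Prop) :
  P 0 -> (forall p q, P p -> P q -> P (p + q)) ->
  (forall c m, mdeg m = n -> P (c *: mpolyX R m)) ->
  forall p, p \is ishomog1 n mdeg -> P p.
Proof.
move=> P0 PD PX p /dhomogP hp; rewrite (mpolyE p) big_seq.
by elim/big_ind: _ => // m /hp; exact: PX.
Qed.

Lemma dhomog_mderiv n p i :
  p \is ishomog1 n.+1 mdeg -> mderiv i p \is ishomog1 n mdeg.
Proof.
elim/dhomog_ind => [|q r hq hr|c m hm]; first by rewrite mderiv0 dhomog0.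
  by rewrite mderivD dhomogD.
rewrite mderivZ mderivX dhomogZ //.
(* If [X_i] does not occur in the monomial, the truncated exponent has the wrong degree, but its
   coefficient is 0. *)
have [->|mi0] := posnP (m i); first by rewrite scale0r dhomog0.
rewrite dhomogZ // dhomogX.
have e : mnm_add (mnm_sub m (mnm1 i)) (mnm1 i) = m.
  apply/mnmP => j; rewrite mnmDE mnmBE mnm1E.
  by case: eqVneq => [<-|_]; rewrite ?subn0 ?addn0 // subnK.
by rewrite -eqSS -hm -{2}e mdegD mdeg1 addn1.
Qed.

Lemma euler_identity n p : p \is ishomog1 n mdeg -> forall x,
  x 0 0 * poly_fun (mderiv 0 p) x + x 0 1 * poly_fun (mderiv 1 p) x
    = n%:R * poly_fun p x.
Proof.
move=> hp x; rewrite /poly_fun; move: p hp.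
apply: dhomog_ind => [|q r hq hr|c m hm].
- by rewrite !mderiv0 !meval0 !mulr0 addr0.
- rewrite !mderivD !mevalD [RHS]mulrDr -hq -hr; ring.
rewrite !mderivZ !mderivX !mevalZ !mevalX !prod_ord2 !mnmBE !mnm1E.
rewrite /= !subn0 -hm mdeg_ord2 natrD.
(* At k = 0 the truncated exponent [k - 1] is harmless, because the factor [k%:R] vanishes. *)
have e (k : nat) (y : R) : y * (k%:R * y ^+ (k - 1)) = k%:R * y ^+ k.
  by case: k => [|k]; [rewrite !mul0r mulr0 | rewrite subSS subn0 mulrCA -exprS].
transitivity (c * ((x 0 0 * ((m 0)%:R * x 0 0 ^+ (m 0 - 1))) * x 0 1 ^+ m 1 +
   x 0 0 ^+ m 0 * (x 0 1 * ((m 1)%:R * x 0 1 ^+ (m 1 - 1))))); first by ring.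
rewrite !e; ring.
Qed.

Lemma poly_fun_scale n p (r : R) x : p \is ishomog1 n mdeg ->
  poly_fun p (r *: x) = r ^+ n * poly_fun p x.
Proof.
move=> hp; rewrite /poly_fun; move: p hp.
apply: dhomog_ind => [|q s hq hs|c m hm].
- by rewrite !meval0 mulr0.
- by rewrite !mevalD hq hs mulrDr.
by rewrite !mevalZ !mevalX !prod_ord2 !mxE -hm mdeg_ord2 exprD !exprMn; ring.
Qed.

(** Zeros of the form in directions other than (1, 0) become roots; a zero at (1, 0) shows up as a
    drop of the degree below that of the form. *)
Definition dehomogenize p : {poly R} :=
  mmap (@polyC R) (fun i : 'I_2 => if i == 0 then 'X else 1) p.

Lemma dehomogenizeD : {morph dehomogenize : p q / p + q}.
Proof. by move=> p q; rewrite /dehomogenize rmorphD. Qed.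

Lemma dehomogenizeB : {morph dehomogenize : p q / p - q}.
Proof. by move=> p q; rewrite /dehomogenize rmorphB. Qed.

Lemma dehomogenizeM : {morph dehomogenize : p q / p * q}.
Proof. by move=> p q; rewrite /dehomogenize rmorphM. Qed.

Lemma dehomogenize0 : dehomogenize 0 = 0.
Proof. by rewrite /dehomogenize rmorph0. Qed.

Lemma dehomogenizeZX c m :
  dehomogenize (c *: mpolyX R m) = c *: 'X^(m 0).
Proof.
rewrite /dehomogenize mmapZ mmapX /mmap1 prod_ord2 /= expr1n mulr1.
by rewrite mul_polyC.
Qed.

Lemma size_dehomogenize n p : p \is ishomog1 n mdeg ->
  (size (dehomogenize p) <= n.+1)%N.
Proof.
elim/dhomog_ind => [|q s hq hs|c m hm].
- by rewrite dehomogenize0 size_poly0.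
- by rewrite dehomogenizeD (leq_trans (size_polyD _ _)) // geq_max hq.
rewrite dehomogenizeZX (leq_trans (size_scale_leq _ _)) // size_polyXn.
by rewrite -hm mdeg_ord2 ltnS leq_addr.
Qed.

Lemma poly_fun_dehomogenize n p x : p \is ishomog1 n mdeg ->
  poly_fun p x
    = \sum_(k < n.+1) (dehomogenize p)`_k * (x 0 0 ^+ k * x 0 1 ^+ (n - k)).
Proof.
rewrite /poly_fun; move: p; apply: dhomog_ind => [|q s hq hs|c m hm].
- by rewrite meval0 dehomogenize0 big1 // => k _; rewrite coef0 mul0r.
- rewrite mevalD hq hs -big_split /=; apply: eq_bigr => k _.
  by rewrite dehomogenizeD coefD mulrDl.
have lm : (m 0%R < n.+1)%N by rewrite ltnS -hm mdeg_ord2 leq_addr.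
rewrite (bigD1 (Ordinal lm)) //= big1 => [|k hk].
  rewrite addr0 dehomogenizeZX coefZ coefXn eqxx mulr1 mevalZ mevalX prod_ord2.
  by rewrite -hm mdeg_ord2 addKn.
rewrite dehomogenizeZX coefZ coefXn; case: eqP => [e|]; last by rewrite mulr0 mul0r.
by case/eqP: hk; exact: val_inj.
Qed.

Lemma dehomogenize_mderiv0 p :
  dehomogenize (mderiv 0 p) = (dehomogenize p)^`().
Proof.
elim/mpolyind: p => [|c m p _ _ ih].
  by rewrite mderiv0 dehomogenize0 deriv0.
rewrite mderivD !dehomogenizeD derivD ih mderivZ mderivX scalerA.
by rewrite !dehomogenizeZX derivZ derivXn mnmBE mnm1E eqxx subn1 -[in RHS]scaler_nat scalerA.
Qed.

(** This is Euler's identity with the second variable set to 1. It expresses all derivatives of the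
    form through derivatives of one univariate polynomial. *)
Lemma dehomogenize_mderiv1 n p : p \is ishomog1 n mdeg ->
  dehomogenize (mderiv 1 p)
    = n%:R *: dehomogenize p - 'X * (dehomogenize p)^`().
Proof.
elim/dhomog_ind => [|q s hq hs|c m hm].
- by rewrite mderiv0 dehomogenize0 deriv0 scaler0 mulr0 subr0.
- by rewrite mderivD !dehomogenizeD hq hs derivD scalerDr mulrDr opprD addrACA.
rewrite mderivZ mderivX scalerA !dehomogenizeZX derivZ derivXn mnmBE mnm1E /=.
rewrite subn0 -hm mdeg_ord2.
have -> : 'X * (c *: ('X^((m 0%R).-1) *+ m 0)) = (c * (m 0)%:R) *: 'X^(m 0) :> {poly R}.
  rewrite -scalerAr [X in _ *: X]mulrnAr -scalerMnr scalerMnl mulr_natr.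
  by case: (m 0) => [|k]; rewrite ?mulr0n ?scale0r // -exprS.
by rewrite scalerA -scalerBl; congr (_ *: _); rewrite natrD; ring.
Qed.

Definition hessian_mpoly p : mpoly 2 R :=
  mderiv 0 (mderiv 0 p) * mderiv 1 (mderiv 1 p) - mderiv 0 (mderiv 1 p) ^+ 2.

Lemma dhomog_hessian n p : p \is ishomog1 n.+2 mdeg ->
  p * hessian_mpoly p \is ishomog1 (n.+2 + (n + n)) mdeg.
Proof.
move=> hp; apply: dhomogM => //; rewrite /hessian_mpoly expr2.
by rewrite rpredB // dhomogM // !dhomog_mderiv.
Qed.
End BinaryForms.

(** * Forms with identically vanishing Hessian determinant *)

Section PowersOfLinearForms.
Context {R : realType}.
Implicit Types (P Q : {poly R}).

Lemma coefM_top (P Q : {poly R}) d e : (size P <= d.+1)%N -> (size Q <= e.+1)%N ->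
  (P * Q)`_(d + e) = P`_d * Q`_e.
Proof.
move=> hP hQ; have ld : (d < (d + e).+1)%N by rewrite ltnS leq_addr.
rewrite coefM (bigD1 (Ordinal ld)) //= addKn big1 ?addr0 // => k hk.
have [kd|dk|e'] := ltngtP k d; last by case/eqP: hk; exact: val_inj.
  rewrite [Q`__]nth_default ?mulr0 // (leq_trans hQ) // ltn_subRL.
  by rewrite ltn_add2r.
by rewrite [P`__]nth_default ?mul0r // (leq_trans hP).
Qed.

(** Choose l so that S = Q - l P has no term of degree d = deg P. The Wronskian of S and P still
    vanishes, and comparing top coefficients forces deg S = d unless S = 0. *)
Lemma wronskian0_proportional P Q : P != 0 -> Q^`() * P = Q * P^`() ->
  exists l, Q = l *: P.
Proof.
move=> P0 W; pose d := (size P).-1; pose l := Q`_d / lead_coef P; exists l.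
apply/eqP; rewrite -subr_eq0; apply/negPn/negP; set S := Q - _ => S0.
have Sd : S`_d = 0.
  by rewrite /S coefB coefZ /l -/(lead_coef P) divfK ?subrr // lead_coef_eq0.
have WS : ('X * S^`()) * P = S * ('X * P^`()).
  rewrite -mulrA [RHS]mulrCA; congr (_ * _).
  by rewrite /S derivB derivZ !mulrBl W -!scalerAl [P^`() * P]mulrC.
pose e := (size S).-1.
have sP : (size P <= d.+1)%N by rewrite /d leqSpred.
have sS : (size S <= e.+1)%N by rewrite /e leqSpred.
have sX (T : {poly R}) k : (size T <= k.+1)%N ->
    (size ('X * T^`())%R <= k.+1)%N /\ ('X * T^`())`_k = k%:R * T`_k.
  move=> hT; split.
    apply/leq_sizeP => j hj; rewrite coefXM; case: j hj => //= j hj.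
    by rewrite coef_deriv nth_default ?mul0rn // (leq_trans hT).
  by rewrite coefXM; case: k {hT} => [|k] /=; rewrite ?mul0r // coef_deriv mulr_natl.
have [sP' cP] := sX _ _ sP; have [sS' cS] := sX _ _ sS.
have lP0 : P`_d != 0 by rewrite -lead_coefE lead_coef_eq0.
have lS0 : S`_e != 0 by rewrite -lead_coefE lead_coef_eq0.
have : e%:R * (S`_e * P`_d) = d%:R * (S`_e * P`_d).
  rewrite mulrA -cS -(coefM_top _ _ _ _ sS' sP) WS (coefM_top _ _ _ _ sS sP') cP; ring.
move/mulIf => /(_ (mulf_neq0 lS0 lP0))/eqP; rewrite eqr_nat => /eqP ed.
by move: lS0; rewrite ed Sd eqxx.
Qed.

(** Translating by l turns the equation into n Q = X Q', which reads (n - k) Q_k = 0 on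
    coefficients, so only the monomial of degree n survives. *)
Lemma deriv_eq_power n P (l : R) : n%:R *: P = ('X + l%:P) * P^`() ->
  exists c, P = c *: ('X + l%:P) ^+ n.
Proof.
move=> hP; pose Q := P \Po ('X - l%:P).
have hQ : n%:R *: Q = 'X * Q^`().
  rewrite /Q deriv_comp derivB derivX derivC subr0 mulr1 -comp_polyZ hP.
  by rewrite comp_polyM comp_polyD comp_polyX comp_polyC subrK.
have PQ : P = Q \Po ('X + l%:P).
  by rewrite /Q -comp_polyA comp_polyB comp_polyX comp_polyC addrK comp_polyXr.
exists Q`_n; rewrite PQ; suff -> : Q \Po ('X + l%:P) = (Q`_n *: 'X^n) \Po ('X + l%:P).
  by rewrite comp_polyZ comp_Xn_poly; congr (_ *: _); rewrite coefZ coefXn eqxx mulr1.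
congr (_ \Po _); apply/polyP => k; rewrite coefZ coefXn.
case: eqVneq => [->|kn]; first by rewrite mulr1.
have /(congr1 (fun T : {poly R} => T`_k)) := hQ.
have -> : ('X * Q^`())`_k = k%:R * Q`_k.
  by rewrite coefXM; case: {kn} k => [|k] /=; rewrite ?mul0r // coef_deriv mulr_natl.
rewrite coefZ mulr0 => /eqP; rewrite -subr_eq0 -mulrBl mulf_eq0 => /orP[|/eqP//].
by rewrite subr_eq0 eqr_nat eq_sym (negPf kn).
Qed.

(** The equation says that P' and Q = n P - X P', the dehomogenized partial derivatives, have zero
    Wronskian. Hence Q = l P' when P' is nonzero, that is n P = (X + l) P'. *)
Lemma hessian_ode_power n P : (0 < n)%N ->
  n%:R *: (P * P^`()^`()) = n.-1%:R *: P^`() ^+ 2 ->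
  (exists c, P = c%:P) \/ exists c l, P = c *: ('X + l%:P) ^+ n.
Proof.
case: n => // n _ /= ode.
have [dP0|dP0] := eqVneq P^`() 0.
  left; exists P`_0; apply/polyP => -[|k]; rewrite coefC //=.
  have /(congr1 (fun T : {poly R} => T`_k)) := dP0.
  by rewrite coef_deriv coef0 -mulr_natl => /eqP; rewrite mulf_eq0 pnatr_eq0 => /eqP.
right; pose Q := n.+1%:R *: P - 'X * P^`().
have [l Ql] : exists l, Q = l *: P^`().
  apply: wronskian0_proportional => //.
  rewrite /Q derivB derivZ derivM derivX mul1r !mulrBl -!scalerAl ode mulrDl.
  rewrite -!mul_polyC !polyC_natr -!natr1; ring.
have [|c ->] := deriv_eq_power n.+1 P l; last by exists c, l.
  by rewrite mulrDl mul_polyC -Ql /Q addrC subrK.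
Qed.

Lemma power_of_linear_form_hessian0 n (p : mpoly 2 R) :
  (1 < n)%N -> p \is ishomog1 n mdeg ->
  dehomogenize (p * hessian_mpoly p) = 0 -> power_of_linear_form n (poly_fun p).
Proof.
case: n => [|[|n]] // _ hp.
set P := dehomogenize p.
(* For degree m = n + 2 the Hessian determinant becomes (m - 1) (m P P'' - (m - 1) P'^2), whose
   vanishing is the differential equation above. *)
have DE : dehomogenize (hessian_mpoly p) =
    n.+1%:R *: (n.+2%:R *: (P * P^`()^`()) - n.+1%:R *: P^`() ^+ 2).
  rewrite dehomogenizeB expr2 !dehomogenizeM !dehomogenize_mderiv0.
  rewrite (dehomogenize_mderiv1 n.+1) ?dhomog_mderiv //.
  rewrite (dehomogenize_mderiv1 n.+2) // -/P.
  rewrite !derivB !derivM !derivZ derivX -!mul_polyC !polyC_natr -!natr1; ring.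
rewrite dehomogenizeM -/P => /eqP; rewrite mulf_eq0 DE => /orP[/eqP P0|].
  exists 0, 0, 0 => x; rewrite (poly_fun_dehomogenize n.+2) // big1 ?mul0r // => k _.
  by rewrite -/P P0 coef0 mul0r.
rewrite scaler_eq0 pnatr_eq0 subr_eq0 /= => /eqP ode.
have [[c Pc]|[c [l Pc]]] := hessian_ode_power n.+2 P isT ode.
  (* A constant dehomogenization comes from a multiple of a power of the second variable, a linear
     form that does not have the shape X + l. *)
  exists c, 0, 1 => x; rewrite (poly_fun_dehomogenize n.+2) // -/P Pc big_ord_recl big1.
    by rewrite coefC /= expr0 mul1r addr0 mul0r mul1r add0r.
  by move=> k _; rewrite coefC /= mul0r.
exists c, 1, l => x; rewrite (poly_fun_dehomogenize n.+2) // -/P Pc mul1r.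
rewrite [x 0 0 + _]addrC [in RHS]exprDn [RHS]mulr_sumr; apply: eq_bigr => k _.
rewrite coefZ -mulrA; congr (c * _).
rewrite ['X + _]addrC exprDn coef_sum (bigD1 k) //= big1 ?addr0; last first.
  move=> j jk; rewrite coefMn -rmorphXn /= coefCM coefXn.
  by rewrite eq_sym (inj_eq val_inj) (negPf jk) mulr0 mul0rn.
rewrite coefMn -rmorphXn /= coefCM coefXn eqxx mulr1 exprMn -mulr_natr -mulr_natr; ring.
Qed.
End PowersOfLinearForms.

(** * Principal curvatures and distance to infinity on a graph *)

Section Curvature.
Context {R : realType}.
Implicit Types (f : 'rV[R]_2 -> R) (x : 'rV[R]_2).

Lemma det_mx22 (A : 'M[R]_2) : \det A = A 0 0 * A 1 1 - A 0 1 * A 1 0.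
Proof.
rewrite (expand_det_row _ 0) sum_ord2 /cofactor !det_mx11 !mxE /=.
have -> : lift 0 0 = 1 :> 'I_2 by exact/val_inj.
have -> : lift 1 0 = 0 :> 'I_2 by exact/val_inj.
by rewrite /= !(expr0, expr1); ring.
Qed.

Lemma char_poly_mx22 (A : 'M[R]_2) (k1 k2 : R) :
  char_poly A = ('X - k1%:P) * ('X - k2%:P) ->
  k1 + k2 = A 0 0 + A 1 1 /\ k1 * k2 = A 0 0 * A 1 1 - A 0 1 * A 1 0.
Proof.
move=> h; split.
  have := @char_poly_trace _ _ A isT; rewrite h /mxtrace sum_ord2 /=.
  rewrite coefM !big_ord_recl big_ord0 /= !coefB !coefX !coefC /=.
  by move=> /(congr1 -%R); rewrite opprK => <-; ring.
rewrite -det_mx22; have := char_poly_det A; rewrite h sqrrN expr1n mul1r => <-.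
by rewrite coefM big_ord1 !coefB !coefX !coefC /=; ring.
Qed.

Lemma area_density_gt0 f x : 0 < area_density f x.
Proof.
rewrite sqrtr_gt0; have := sqr_ge0 (partial f 0 x); have := sqr_ge0 (partial f 1 x); lra.
Qed.

Lemma area_density_sqr f x :
  area_density f x ^+ 2 = 1 + partial f 0 x ^+ 2 + partial f 1 x ^+ 2.
Proof.
rewrite sqr_sqrtr //; have := sqr_ge0 (partial f 0 x); have := sqr_ge0 (partial f 1 x); lra.
Qed.

(** The shape operator S satisfies G S = H / W, where G is the first form, with det G = W^2, and H
    the Hessian. Writing L, M, N through the entries of S yields its trace and determinant without
    inverting G. *)
Lemma principal_curvaturesE f x k1 k2 :
  principal_curvatures f x k1 k2 -> hess f x 1 0 = hess f x 0 1 ->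
  let W := area_density f x in
  let a := partial f 0 x in let b := partial f 1 x in
  let L := hess f x 0 0 in let M := hess f x 0 1 in let N := hess f x 1 1 in
  (k1 + k2) * W ^+ 3 = L + N + (b ^+ 2 * L - 2 * a * b * M + a ^+ 2 * N) /\
  k1 * k2 * W ^+ 4 = L * N - M ^+ 2.
Proof.
move=> /char_poly_mx22 [-> ->] symH W a b L M N.
have W0 : W != 0 by rewrite gt_eqF // area_density_gt0.
have W2 : W ^+ 2 = 1 + a ^+ 2 + b ^+ 2 by exact: area_density_sqr.
set S := shape_operator f x.
have GE : [/\ first_form f x 0 0 = 1 + a ^+ 2, first_form f x 0 1 = a * b,
              first_form f x 1 0 = a * b & first_form f x 1 1 = 1 + b ^+ 2].
  by split; rewrite !mxE big_ord1 !mxE /= ?mulr1n ?mulr0n ?add0r // -/a -/b mulrC.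
have [g00 g01 g10 g11] := GE.
have Gu : first_form f x \in unitmx.
  rewrite unitmxE det_mx22 unitfE g00 g01 g10 g11.
  have -> : (1 + a ^+ 2) * (1 + b ^+ 2) - a * b * (a * b) = W ^+ 2 by rewrite W2; ring.
  by rewrite expf_neq0.
have GS : first_form f x *m S = W^-1 *: hess f x by rewrite mulKVmx.
have e i j : first_form f x i 0 * S 0 j + first_form f x i 1 * S 1 j = W^-1 * hess f x i j.
  by have := congr1 (fun Z : 'M[R]_2 => Z i j) GS; rewrite mxE sum_ord2 => ->; rewrite [in LHS]mxE.
have e00 : W * ((1 + a ^+ 2) * S 0 0 + a * b * S 1 0) = L.
  by rewrite -g00 -g01 e mulVKf.
have e01 : W * ((1 + a ^+ 2) * S 0 1 + a * b * S 1 1) = M.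
  by rewrite -g00 -g01 e mulVKf.
have e10 : W * (a * b * S 0 0 + (1 + b ^+ 2) * S 1 0) = M.
  by rewrite -g10 -g11 e symH mulVKf.
have e11 : W * (a * b * S 0 1 + (1 + b ^+ 2) * S 1 1) = N.
  by rewrite -g10 -g11 e mulVKf.
split.
  have -> : L + N + (b ^+ 2 * L - 2 * a * b * M + a ^+ 2 * N) =
    (1 + b ^+ 2) * L - a * b * M - a * b * M + (1 + a ^+ 2) * N by ring.
  (* By symmetry M has two expressions in the entries of S; each occurrence of M is replaced by a
     different one. *)
  rewrite -{1}e10 -{1}e01 -e00 -e11.
  have -> : W ^+ 3 = W * W ^+ 2 by ring.
  by rewrite W2; ring.
have -> : M ^+ 2 = M * M by ring.
rewrite -{1}e10 -e01 -e00 -e11.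
have -> : W ^+ 4 = W * W * W ^+ 2 by ring.
by rewrite W2; ring.
Qed.

(** With rho = |xi|, W = (1 + rho^2) / (1 - rho^2), so the product is (1 + rho^2) / (1 + rho), which
    stays between 1/2 and 1 for 0 <= rho < 1. *)
Lemma area_density_dist_infty f x xi : gauss_coordinate f x xi ->
  0 < dist_infty xi /\ 1 / 2 <= area_density f x * dist_infty xi <= 1.
Proof.
move=> h; have [+ _] := (gauss_coordinateP f x xi).1 h.
have W0 := area_density_gt0 f x.
case: h => _; case: xi => a b; rewrite /dist_infty /normal_ver.
set W := area_density f x in W0 *.
set rho := ComplexField.Normc.normc _ => hv r1.
have r0 : 0 <= rho by exact: sqrtr_ge0.
have r2 : rho ^+ 2 = a ^+ 2 + b ^+ 2.
  by rewrite sqr_sqrtr // addr_ge0 // sqr_ge0.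
have nE : (a +i* b)%C * (a +i* b)%C^* = (rho ^+ 2)%:C%C.
  by rewrite r2; apply/eqP; rewrite eq_complex /=; apply/andP; split; apply/eqP; ring.
have r20 := sqr_ge0 rho.
have {hv} hv : (1 - rho ^+ 2) / (1 + rho ^+ 2) = W^-1.
  apply: (@complexI R); rewrite -hv nE.
  by rewrite !(rmorphB, rmorphD, rmorphM, fmorphV, rmorph1).
have r3 : 1 + rho ^+ 2 != 0 by rewrite gt_eqF //; lra.
have r4 : 1 - rho != 0 by rewrite gt_eqF //; lra.
have r5 : 1 + rho != 0 by rewrite gt_eqF //; lra.
have -> : W = (1 + rho ^+ 2) / (1 - rho ^+ 2) by rewrite -[LHS]invrK -hv invf_div.
have -> : 1 - rho ^+ 2 = (1 - rho) * (1 + rho) by ring.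
have -> : (1 + rho ^+ 2) / ((1 - rho) * (1 + rho)) * (1 - rho) = (1 + rho ^+ 2) / (1 + rho).
  by field; rewrite r4 r5.
split; first by lra.
rewrite ler_pdivlMr ?ler_pdivrMr; [|lra|lra].
apply/andP; split; first by nra.
by nra.
Qed.

(* [V] equals [W^2 (k1 - k2)^2] with [W] the area density. *)
Lemma umbilic_ratio_bounds f x k1 k2 xi :
  principal_curvatures f x k1 k2 -> hess f x 1 0 = hess f x 0 1 ->
  gauss_coordinate f x xi ->
  let w := 1 + partial f 0 x ^+ 2 + partial f 1 x ^+ 2 in
  let a := partial f 0 x in let b := partial f 1 x in
  let L := hess f x 0 0 in let M := hess f x 0 1 in let N := hess f x 1 1 in
  let V := (L + N + (b ^+ 2 * L - 2 * a * b * M + a ^+ 2 * N)) ^+ 2 / w ^+ 2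
           - 4 * (L * N - M ^+ 2) / w in
  V <= (`|k1 - k2| / dist_infty xi) ^+ 2 /\
  (`|k1 - k2| / dist_infty xi) ^+ 2 <= 4 * V.
Proof.
move=> hk symH hxi w a b L M N V.
have [ht hd] := principal_curvaturesE _ _ _ _ hk symH.
have [d0 /andP[Wd1 Wd2]] := area_density_dist_infty _ _ _ hxi.
have := area_density_gt0 f x.
have w2 : w = area_density f x ^+ 2 by rewrite area_density_sqr.
move: ht hd Wd1 Wd2 w2; rewrite /=; set W := area_density f x.
move=> ht hd Wd1 Wd2 w2 W0.
have Wn0 : W != 0 by rewrite gt_eqF.
have VE : V = (W * `|k1 - k2|) ^+ 2.
  by rewrite exprMn real_normK ?num_real // /V -ht -hd w2; field.
set d := dist_infty xi in d0 Wd1 Wd2 *.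
have nE : `|k1 - k2| / d = (W * `|k1 - k2|) / (W * d) by field; rewrite Wn0 gt_eqF.
have Wd0 : 0 < W * d by rewrite mulr_gt0.
have y0 : 0 <= (W * `|k1 - k2|) ^+ 2 by exact: sqr_ge0.
rewrite VE nE [(_ / (W * d)) ^+ 2]expr_div_n; move: y0; set y := _ ^+ 2 => y0.
have Wd3 : 0 < (W * d) ^+ 2 by rewrite exprn_gt0.
rewrite ler_pdivlMr // ler_pdivrMr //; split.
  by rewrite ler_piMr // expr_le1 // ltW.
(* The lower bound 1/2 on W d, squared, gives the factor 4. *)
have : 1 / 4 <= (W * d) ^+ 2 by nra.
by nra.
Qed.
End Curvature.

(** * Asymptotics of the umbilic ratio along a ray *)

Section Limits.
Context {R : realType}.
Implicit Types (a b L M N r : R).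

Lemma cvg0_of_sqr_bound (X : R -> R) (C : R) :
  (forall r, 1 <= r -> (X r) ^+ 2 <= C / r ^+ 2) -> X r @[r --> +oo] --> (0 : R).
Proof.
move=> hX; have C0 : 0 <= C by have := hX 1 (lexx _); have := sqr_ge0 (X 1); rewrite expr1n divr1; lra.
apply/cvgrPdist_lt => e e0; near=> r; rewrite sub0r normrN.
have r1 : 1 <= r by near: r; apply: nbhs_pinfty_ge; rewrite num_real.
(* The summand 1 makes the final inequality strict: C + 1 <= e^2 r <= e^2 r^2. *)
have r2 : (C + 1) / e ^+ 2 <= r by near: r; apply: nbhs_pinfty_ge; rewrite num_real.
rewrite -(@ltr_pXn2r _ 2) ?nnegrE ?normr_ge0 ?(ltW e0) // real_normK ?num_real //.
apply: le_lt_trans (hX _ r1) _; rewrite ltr_pdivrMr; last by rewrite exprn_gt0 //; lra.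
move: r2; rewrite ler_pdivrMr ?exprn_gt0 // => r2.
have : r * e ^+ 2 <= e ^+ 2 * r ^+ 2 by have := sqr_ge0 e; nra.
lra.
Unshelve. all: by end_near.
Qed.

Lemma ncvg0_of_sqr_bound (X : R -> R) (c r0 : R) : 0 < c ->
  (forall r, r0 <= r -> c <= (X r) ^+ 2) -> ~ X r @[r --> +oo] --> (0 : R).
Proof.
move=> c0 hX /cvgrPdist_lt /(_ (Num.sqrt c)); rewrite sqrtr_gt0 => /(_ c0) h.
have : \forall r \near +oo, r0 <= r by apply: nbhs_pinfty_ge; rewrite num_real.
move=> h'; near (pinfty_nbhs R) => r.
have : `|0 - X r| < Num.sqrt c by near: r.
have : c <= (X r) ^+ 2 by apply: hX; near: r.
rewrite sub0r normrN => h1; rewrite ltNge => /negP; apply.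
by rewrite -(@ler_pXn2r _ 2) ?nnegrE ?normr_ge0 ?sqrtr_ge0 // real_normK ?num_real // sqr_sqrtr // ltW.
Unshelve. all: by end_near.
Qed.

(* [V] is the quantity of [umbilic_ratio_bounds] at distance [r] from the origin: the gradient
   scales by [s = r^(n-1)], the Hessian by [h = r^(n-2)], so [s = h r]. *)
Lemma scaled_ratio_cvg a b L M N (h : R -> R) (X : R -> R) :
  (forall r, 1 <= r -> 1 <= h r) ->
  let q := b ^+ 2 * L - 2 * a * b * M + a ^+ 2 * N in
  let D := L * N - M ^+ 2 in
  (a = 0 -> b = 0 -> D = 0) ->
  let V r := let s := h r * r in let w := 1 + (s * a) ^+ 2 + (s * b) ^+ 2 in
    (h r * (L + N) + s ^+ 2 * h r * q) ^+ 2 / w ^+ 2 - 4 * (h r ^+ 2 * D) / w in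
  (forall r, 1 <= r -> V r <= X r ^+ 2 /\ X r ^+ 2 <= 4 * V r) ->
  X r @[r --> +oo] --> (0 : R) <->
  q = 0 /\ (a = 0 -> b = 0 -> L + N = 0).
Proof.
move=> h1 q D hD V hX.
pose g := a ^+ 2 + b ^+ 2.
have wE r : 1 + (h r * r * a) ^+ 2 + (h r * r * b) ^+ 2 = 1 + (h r * r) ^+ 2 * g.
  by rewrite /g; ring.
have g0 : 0 <= g by rewrite addr_ge0 ?sqr_ge0.
have s1 r : 1 <= r -> r <= h r * r.
  by move=> r1; rewrite ler_peMl ?h1 //; lra.
(* Where the gradient vanishes, [hD] reduces V to h^2 (L + N)^2, and h >= 1 keeps this away from 0
   unless L + N = 0. *)
have [ge0|gn0] := eqVneq g 0.
  have [a0 b0] : a = 0 /\ b = 0.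
    move/eqP: ge0; rewrite paddr_eq0 ?sqr_ge0 // !sqrf_eq0.
    by move=> /andP[/eqP-> /eqP->].
  have q0 : q = 0 by rewrite /q a0 b0; ring.
  have VE r : V r = h r ^+ 2 * (L + N) ^+ 2.
    rewrite /V /= hD // q0 a0 b0 !mulr0 expr0n /= !addr0 expr1n.
    by rewrite mul0r subr0 invr1 mulr1 exprMn.
  split => [cX|[_ T0]].
    split=> // _ _; apply/eqP; apply/negPn/negP => T0.
    apply: (ncvg0_of_sqr_bound X ((L + N) ^+ 2) 1 _ _ cX).
      by rewrite exprn_even_gt0.
    move=> r r1; apply: le_trans (hX r r1).1; rewrite VE.
    by rewrite ler_peMl ?sqr_ge0 // exprn_ege1 // h1.
  apply: (@cvg0_of_sqr_bound X 0) => r r1; rewrite mul0r.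
  by apply: le_trans (hX r r1).2 _; rewrite VE T0 // expr0n /= !mulr0.
have {gn0 g0} g0 : 0 < g by rewrite lt_neqAle eq_sym gn0.
have ab0 : ~ (a = 0 /\ b = 0).
  by move=> [a0 b0]; move: g0; rewrite /g a0 b0 expr0n /= addr0 ltxx.
have sq r : 1 <= r -> [/\ 0 < r, 1 <= h r, 1 <= r ^+ 2, r ^+ 2 <= (h r * r) ^+ 2
    & h r ^+ 2 = (h r * r) ^+ 2 / r ^+ 2].
  move=> r1; have r0 : 0 < r by lra.
  have hr := h1 r r1.
  split=> //; first by rewrite exprn_ege1.
    rewrite lerXn2r ?nnegrE ?s1 //; first lra.
    by rewrite mulr_ge0 //; lra.
  by field; rewrite gt_eqF.
(* The determinant term is O(1/r^2) whatever q is, since h^2 = s^2 / r^2 and s^2 / (1 + s^2 g) <= 1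
   / g. *)
have Dw r : 1 <= r -> `|4 * (h r ^+ 2 * D) / (1 + (h r * r) ^+ 2 * g)|
    <= 4 * `|D| / g / r ^+ 2.
  move=> /sq [r0 hr r2 s2 ->]; set s := (h r * r) ^+ 2 in s2 *.
  have s0 : 0 < s by lra.
  have w0 : 0 < 1 + s * g by rewrite addr_gt0 // mulr_gt0.
  have -> : 4 * (s / r ^+ 2 * D) / (1 + s * g) = (s / (1 + s * g)) * (4 * D / r ^+ 2).
    by field; rewrite !gt_eqF.
  have -> : 4 * `|D| / g / r ^+ 2 = g^-1 * `|4 * D / r ^+ 2|.
    rewrite normrM normrM normfV (ger0_norm (_ : 0 <= r ^+ 2)) ?sqr_ge0 // normr_nat.
    by field; rewrite !gt_eqF.
  have sw0 : 0 <= s / (1 + s * g) by rewrite divr_ge0 // ltW.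
  rewrite normrM ler_wpM2r // (ger0_norm sw0).
  rewrite ler_pdivrMr // mulrDr mulrCA mulVf ?gt_eqF // !mulr1 lerDr.
  by rewrite invr_ge0 ltW.
have [q0|q0] := eqVneq q 0; split => //.
- by move=> _; split=> // a0 b0; case: ab0.
(* Without q the first term of V is at most (L + N)^2 / (g^2 r^2), because s >= 1; [Dw] bounds the
   second, and the outer 4 comes from X^2 <= 4 V. *)
- move=> _; apply: (@cvg0_of_sqr_bound X (4 * ((L + N) ^+ 2 / g ^+ 2 + 4 * `|D| / g))) => r r1.
  apply: le_trans (hX r r1).2 _; rewrite -[4 * _ / _]mulrA ler_pM2l // /V /= wE q0 mulr0 addr0.
  have [rp hr r2 s2 hE] := sq r r1.
  have := ler_norm (- (4 * (h r ^+ 2 * D) / (1 + (h r * r) ^+ 2 * g))).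
  rewrite normrN => /le_trans /(_ (Dw r r1)) hD2.
  rewrite [leRHS]mulrDl; apply: lerD => //.
  rewrite exprMn hE; set s := (h r * r) ^+ 2 in s2 *.
  have s0 : 0 < s by lra.
  have w0 : 0 < 1 + s * g by rewrite addr_gt0 // mulr_gt0.
  have -> : s / r ^+ 2 * (L + N) ^+ 2 / (1 + s * g) ^+ 2
     = (s / (1 + s * g) ^+ 2) * ((L + N) ^+ 2 / r ^+ 2) by field; rewrite !gt_eqF.
  have -> : (L + N) ^+ 2 / g ^+ 2 / r ^+ 2 = (g ^+ 2)^-1 * ((L + N) ^+ 2 / r ^+ 2).
    by field; rewrite !gt_eqF.
  rewrite ler_wpM2r ?divr_ge0 ?sqr_ge0 // ler_pdivrMr ?exprn_gt0 //.
  rewrite mulrC ler_pdivlMr ?exprn_gt0 //.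
  have -> : (1 + s * g) ^+ 2 = 1 + 2 * (s * g) + s ^+ 2 * g ^+ 2 by ring.
  have : s * g ^+ 2 <= s ^+ 2 * g ^+ 2.
    by rewrite ler_wpM2r ?sqr_ge0 // expr2 ler_peMl //; lra.
  have : 0 < s * g by rewrite mulr_gt0.
  lra.
- move=> cX; exfalso.
  pose T := L + N.
  (* For large r the q-term dominates T, and 1 + s^2 g <= s^2 (1 + g), so the first term of V is at
     least q^2 / (4 (1 + g)^2) = 2 c. The summands of [r0] ensure r >= 1, the domination of T, and a
     determinant term of at most c, leaving V >= c. *)
  pose c := q ^+ 2 / (8 * (1 + g) ^+ 2).
  have q20 : 0 < q ^+ 2 by rewrite exprn_even_gt0.
  have c0 : 0 < c by rewrite divr_gt0 // mulr_gt0 // exprn_gt0 //; lra.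
  pose r0 := 1 + 2 * `|T| / `|q| + 4 * `|D| / g / c.
  apply: (@ncvg0_of_sqr_bound X c r0 c0 _ cX) => r r0r.
  have t0 : 0 <= 2 * `|T| / `|q| by rewrite divr_ge0 // mulr_ge0.
  have t1 : 0 <= 4 * `|D| / g / c by rewrite divr_ge0 ?(ltW c0) // divr_ge0 ?(ltW g0) // mulr_ge0.
  have r1 : 1 <= r by rewrite /r0 in r0r; lra.
  have rr : r <= r ^+ 2 by rewrite expr2 ler_peMr //; lra.
  have [rp hr r2 s2 hE] := sq r r1.
  apply: le_trans (hX r r1).1; rewrite /V /= wE.
  have := ler_norm (4 * (h r ^+ 2 * D) / (1 + (h r * r) ^+ 2 * g)).
  move=> /le_trans /(_ (Dw r r1)).
  have : 4 * `|D| / g / r ^+ 2 <= c.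
    rewrite ler_pdivrMr ?exprn_gt0 // [leRHS]mulrC -ler_pdivrMr //; apply: le_trans rr.
    by rewrite /r0 in r0r; lra.
  suff : 2 * c <= (h r * (L + N) + (h r * r) ^+ 2 * h r * q) ^+ 2
      / (1 + (h r * r) ^+ 2 * g) ^+ 2 by lra.
  have q1 : 0 < `|q| by rewrite normr_gt0.
  have Tq : 2 * `|T| <= r ^+ 2 * `|q|.
    rewrite -ler_pdivrMr //; apply: le_trans rr.
    by rewrite /r0 in r0r; lra.
  set s := (h r * r) ^+ 2 in s2 *.
  have s0 : 0 < s by lra.
  have w0 : 0 < 1 + s * g by rewrite addr_gt0 // mulr_gt0.
  have -> : h r * (L + N) + s * h r * q = h r * (T + s * q) by rewrite /T; ring.
  have Ts : s * `|q| / 2 <= `|T + s * q|.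
    have := lerB_normD (s * q) T; rewrite [s * q + T]addrC normrM (gtr0_norm s0).
    have : r ^+ 2 * `|q| <= s * `|q| by rewrite ler_wpM2r.
    lra.
  have Tss : s ^+ 2 * q ^+ 2 / 4 <= (h r * (T + s * q)) ^+ 2.
    rewrite [leRHS]exprMn; apply: (@le_trans _ _ ((T + s * q) ^+ 2)); last first.
      by rewrite ler_peMl ?sqr_ge0 // exprn_ege1.
    have -> : s ^+ 2 * q ^+ 2 / 4 = (s * `|q| / 2) ^+ 2.
      by rewrite -[q ^+ 2]real_normK ?num_real //; field.
    rewrite -[leRHS]real_normK ?num_real // lerXn2r ?nnegrE //.
    by rewrite divr_ge0 // mulr_ge0 // ltW.
  rewrite ler_pdivlMr ?exprn_gt0 //; apply: le_trans Tss.
  have ws : (1 + s * g) ^+ 2 <= (s * (1 + g)) ^+ 2.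
    have sg : 0 <= s * (1 + g) by rewrite mulr_ge0 //; lra.
    have sg1 : 1 + s * g <= s * (1 + g) by rewrite [leRHS]mulrDr mulr1; lra.
    by rewrite lerXn2r // nnegrE // ltW.
  apply: le_trans (_ : 2 * c * (s * (1 + g)) ^+ 2 <= _).
    by rewrite ler_wpM2l // mulr_ge0 // ltW.
  by rewrite /c le_eqVlt; apply/orP; left; apply/eqP; field; rewrite gt_eqF //; lra.
- by case=> qE; rewrite qE eqxx in q0.
Qed.
End Limits.

(** * Counting zeros of binary forms by angle *)

Section Counting.
Context {R : realType}.

(** A longest duplicate-free list in B exhausts B, since a missing element could be prepended. This
    turns a bound on lists of zeros into finiteness. *)
Lemma bounded_uniq_seq (T : choiceType) (B : set T) (K : nat) :
  (forall s : seq T, uniq s -> {in s, forall y, B y} -> (size s <= K)%N) ->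
  exists s : seq T, [/\ uniq s, forall y, B y <-> y \in s & (size s <= K)%N].
Proof.
move=> hB; pose P (k : nat) : bool :=
  `[< exists s : seq T, [/\ uniq s, {in s, forall y, B y} & size s = k] >].
have exP : exists k, P k by exists 0%N; apply/asboolP; exists [::].
have leP k : P k -> (k <= K)%N by move=> /asboolP[s [us sB <-]]; exact: hB.
have [k /asboolP[s [us sB <-]] kmax] := ex_maxnP exP leP.
exists s; split=> [//|y|]; last exact: hB.
split=> [By|]; last exact: sB.
apply/negPn/negP => ys; suff : P (size s).+1 by move/kmax; rewrite ltnn.
apply/asboolP; exists (y :: s); split=> //=; first by rewrite ys.
by move=> z; rewrite inE => /orP[/eqP->|/sB].
Qed.

Lemma sin_eq0_pi (t : R) : - pi < t < pi -> sin t = 0 -> t = 0.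
Proof.
move=> /andP[t1 t2] st; have [t0|t0|//] := ltgtP t 0.
  have : 0 < sin (- t) by apply: sin_gt0_pi; lra.
  by rewrite sinN st oppr0 ltxx.
have : 0 < sin t by apply: sin_gt0_pi; lra.
by rewrite st ltxx.
Qed.

Lemma poly_fun_polar n (p : mpoly 2 R) A : p \is ishomog1 n mdeg -> sin A != 0 ->
  poly_fun p (polar 1 A) = sin A ^+ n * (dehomogenize p).[cos A / sin A].
Proof.
move=> hp sA; rewrite (poly_fun_dehomogenize n) //.
rewrite (horner_coef_wide _ (size_dehomogenize _ _ hp)) mulr_sumr.
apply: eq_bigr => k _; rewrite !mxE /= !mul1r expr_div_n.
have -> : sin A ^+ n = sin A ^+ k * sin A ^+ (n - k).
  by rewrite -exprD subnKC // -ltnS.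
by field; rewrite expf_neq0.
Qed.

Lemma poly_fun_polar0 n (p : mpoly 2 R) : p \is ishomog1 n mdeg ->
  poly_fun p (polar 1 0) = (dehomogenize p)`_n.
Proof.
move=> hp; rewrite (poly_fun_dehomogenize n) // big_ord_recr big1 /=.
  by rewrite !mxE /= cos0 !mul1r subnn expr0 expr1n !mulr1 add0r.
move=> k _; rewrite !mxE /= sin0 mulr0 expr0n subn_eq0 leqNgt ltn_ord /=.
by rewrite !mulr0.
Qed.

(** The cotangent is injective on (0, pi) and sends zeros of the form to roots of its
    dehomogenization; the angle 0, where it is undefined, is removed first and counted
    separately. *)
Lemma binary_form_zeros n (p : mpoly 2 R) (s : seq R) : p \is ishomog1 n mdeg ->
  dehomogenize p != 0 -> uniq s ->
  {in s, forall A, 0 <= A < pi /\ poly_fun p (polar 1 A) = 0} ->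
  (size s <= n)%N.
Proof.
move=> hp p0 us sz; pose t := rem 0 s.
have tP A : A \in t -> A != 0 /\ A \in s.
  by rewrite mem_rem_uniq // inE => /andP[].
have tA A : A \in t -> 0 < sin A.
  move=> /tP[A0 /sz[/andP[A1 A2] _]]; apply: sin_gt0_pi.
  by rewrite lt_neqAle eq_sym A0 A1.
have ht : (size t < size (dehomogenize p))%N.
  rewrite -(size_map (fun A => cos A / sin A)); apply: max_poly_roots => //.
    apply/allP => _ /mapP[A At ->]; rewrite rootE.
    have sA := tA _ At; have [_ /sz[_]] := tP _ At.
    have sA0 : sin A != 0 by rewrite gt_eqF.
    rewrite (poly_fun_polar _ _ _ hp sA0) => /eqP.
    by rewrite mulf_eq0 expf_eq0 (gt_eqF sA) andbF.
  rewrite map_inj_in_uniq ?rem_uniq // => A B At Bt.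
  have sA := tA _ At; have sB := tA _ Bt.
  move=> /eqP; rewrite eqr_div ?(gt_eqF sA) ?(gt_eqF sB) // => /eqP AB.
  apply/eqP; rewrite -subr_eq0; apply/eqP; apply: sin_eq0_pi.
    have [_ /sz[? _]] := tP _ At; have [_ /sz[? _]] := tP _ Bt; lra.
  by rewrite sinB AB mulrC subrr.
have := size_dehomogenize _ _ hp.
(* A zero at angle 0 lowers the degree of the dehomogenization. *)
have [s0|s0] := boolP (0 \in s); last first.
  by move=> h; rewrite -ltnS -(rem_id s0) (leq_trans ht).
have [_ z0] := sz _ s0; rewrite (poly_fun_polar0 n) // in z0.
rewrite leq_eqVlt => /orP[/eqP sn|].
  by move: p0; rewrite -lead_coef_eq0 lead_coefE sn /= z0 eqxx.
rewrite ltnS => h; have := leq_trans ht h.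
by rewrite size_rem //; case: (size s) => [|k].
Qed.

(** The part of B in [pi, 2 pi) is the translate by pi of the part in [0, pi), which s lists; this
    doubling is the source of evenness. *)
Lemma card_antipodal (s : seq R) (B : set R) : uniq s ->
  (forall A, 0 <= A < pi -> (B A <-> A \in s)) ->
  {in s, forall A, 0 <= A < pi} ->
  (forall A, B (A + pi) <-> B A) ->
  [set A | 0 <= A < 2 * pi /\ B A] #= `I_(2 * size s).
Proof.
move=> us sB s_pi Bpi; pose t := s ++ map (+%R^~ pi) s.
have pi0 := pi_gt0 R.
have ut : uniq t.
  rewrite cat_uniq us map_inj_uniq ?us ?andbT; last exact: addIr.
  apply/hasPn => _ /mapP[A As ->]; apply/negP => /s_pi.
  by have := s_pi _ As; lra.
have -> : [set A | 0 <= A < 2 * pi /\ B A] = [set` t].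
  apply/seteqP; split=> A /=.
    move=> [/andP[A0 A2] BA]; rewrite mem_cat; apply/orP.
    have [Ap|Ap] := ltP A pi; first by left; apply/sB => //; rewrite A0.
    right; apply/mapP; exists (A - pi); last by rewrite subrK.
    apply/sB; first by lra.
    by apply/Bpi; rewrite subrK.
  rewrite mem_cat => /orP[As|/mapP[A' As ->]].
    by have h := s_pi _ As; split; [lra | apply/sB].
  by have h := s_pi _ As; split; [lra | apply/Bpi/sB].
have -> : (2 * size s)%N = size t by rewrite size_cat size_map mul2n addnn.
rewrite (_ : [set` t] = [set` [fset A in t]%fset]).
  by apply/card_eq_fsetP; rewrite card_fseq undup_id.
by apply/seteqP; split=> A /=; rewrite in_fset.
Qed.
End Counting.

(** * Umbilics at infinity as zeros of a form *)

Section UmbilicDirections.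
Context {R : realType}.
Implicit Types (p : mpoly 2 R) (A r : R) (n : nat).

Lemma polarE r A : polar r A = r *: polar 1 A.
Proof. by apply/rowP => i; rewrite !mxE; case: ifP => _; rewrite mul1r. Qed.

Lemma polarDpi A : polar 1 (A + pi) = -1 *: polar 1 A.
Proof.
by apply/rowP => i; rewrite !mxE cosDpi sinDpi; case: ifP => _; rewrite !mul1r mulN1r.
Qed.

Lemma hess_poly_fun p x i j :
  hess (poly_fun p) x i j = poly_fun (mderiv i (mderiv j p)) x.
Proof. by rewrite mxE !partial_poly_fun. Qed.

(** The first clause stands for q = 0, in a form whose identical vanishing leads to a differential
    equation. The second bears only on directions where the gradient vanishes. *)
Definition umbilic_direction p A : Prop :=
  let u := polar 1 A in
  poly_fun (p * hessian_mpoly p) u = 0 /\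
  (poly_fun (mderiv 0 p) u = 0 -> poly_fun (mderiv 1 p) u = 0 ->
   poly_fun (mderiv 0 (mderiv 0 p)) u + poly_fun (mderiv 1 (mderiv 1 p)) u = 0).

Lemma umbilic_directionDpi n p A : p \is ishomog1 n.+2 mdeg ->
  umbilic_direction p (A + pi) <-> umbilic_direction p A.
Proof.
move=> hp; rewrite /umbilic_direction /= polarDpi.
have hpi i : mderiv i p \is ishomog1 n.+1 mdeg by exact: dhomog_mderiv.
have hpij i j : mderiv i (mderiv j p) \is ishomog1 n mdeg by exact: dhomog_mderiv.
rewrite (poly_fun_scale _ _ _ _ (dhomog_hessian _ _ hp)).
rewrite !(poly_fun_scale _ _ _ _ (hpi _)) !(poly_fun_scale _ _ _ _ (hpij _ _)).
rewrite -mulrDr.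
have e (m : nat) (y : R) : (-1) ^+ m * y = 0 <-> y = 0.
  split=> [/eqP|->]; last by rewrite mulr0.
  by rewrite mulf_eq0 signr_eq0 => /eqP.
by rewrite !e.
Qed.

Lemma umbilic_directionP n p A (k1 k2 : 'rV[R]_2 -> R) (xi : 'rV[R]_2 -> R[i]) :
  p \is ishomog1 n.+2 mdeg ->
  (forall x, principal_curvatures (poly_fun p) x (k1 x) (k2 x)) ->
  (forall x, gauss_coordinate (poly_fun p) x (xi x)) ->
  umbilic_at_infinity k1 k2 xi A <-> umbilic_direction p A.
Proof.
move=> hp hk hxi; rewrite /umbilic_direction /=; set u := polar 1 A.
have hpi i : mderiv i p \is ishomog1 n.+1 mdeg by exact: dhomog_mderiv.
have hpij i j : mderiv i (mderiv j p) \is ishomog1 n mdeg by exact: dhomog_mderiv.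
have := euler_identity _ _ hp u.
have := euler_identity _ _ (hpi 0) u.
have := euler_identity _ _ (hpi 1) u.
rewrite [mderiv 1 (mderiv 0 p)]mderiv_comm.
have -> : poly_fun (p * hessian_mpoly p) u = poly_fun p u *
    (poly_fun (mderiv 0 (mderiv 0 p)) u * poly_fun (mderiv 1 (mderiv 1 p)) u
     - poly_fun (mderiv 0 (mderiv 1 p)) u ^+ 2).
  by rewrite /poly_fun mevalM /hessian_mpoly expr2 mevalB !mevalM expr2.
set F := poly_fun p u; set a := poly_fun (mderiv 0 p) u; set b := poly_fun (mderiv 1 p) u.
set L := poly_fun (mderiv 0 (mderiv 0 p)) u; set M := poly_fun (mderiv 0 (mderiv 1 p)) u.
set N := poly_fun (mderiv 1 (mderiv 1 p)) u.
have u1 : u 0 0 ^+ 2 + u 0 1 ^+ 2 = 1 by rewrite !mxE /= !mul1r cos2Dsin2.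
move: (u 0 0) (u 0 1) u1 => x y xy eb ea eF.
pose D := L * N - M ^+ 2.
pose q := b ^+ 2 * L - 2 * a * b * M + a ^+ 2 * N.
have n1 : (n.+1%:R : R) != 0 by rewrite pnatr_eq0.
have n2 : (n.+2%:R : R) != 0 by rewrite pnatr_eq0.
(* q is the adjugate of the Hessian H evaluated on the gradient. By Euler's identity (n + 1) times
   the gradient is H u, and H adj(H) H = D H; a second use of Euler turns the value of H at u into a
   multiple of F. *)
have qE : n.+1%:R * q = n.+2%:R * (F * D).
  apply: (mulfI n1).
  transitivity ((n.+1%:R * b) ^+ 2 * L - 2 * (n.+1%:R * a) * (n.+1%:R * b) * M
    + (n.+1%:R * a) ^+ 2 * N); first by rewrite /q; ring.
  transitivity (n.+1%:R * D * (n.+2%:R * F)); last by ring.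
  rewrite -eF; transitivity (D * (x * (n.+1%:R * a) + y * (n.+1%:R * b))); last by ring.
  by rewrite -ea -eb /D; ring.
have q0 : q = 0 <-> F * D = 0.
  split=> h; apply/eqP.
    by move: qE; rewrite h mulr0 => /esym/eqP; rewrite mulf_eq0 (negPf n2).
  by move: qE; rewrite h mulr0 => /eqP; rewrite mulf_eq0 (negPf n1).
rewrite -/D -q0.
(* A vanishing gradient gives H u = 0 for the unit vector u, so H is singular. *)
have hD : a = 0 -> b = 0 -> D = 0.
  move=> a0 b0; move: ea eb; rewrite a0 b0 !mulr0 => ea eb.
  rewrite -[D]mulr1 -xy.
  transitivity (x * (N * (x * L + y * M) - M * (x * M + y * N))
    + y * (L * (x * M + y * N) - M * (x * L + y * M))); first by rewrite /D; ring.
  by rewrite ea eb; ring.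
apply: (scaled_ratio_cvg a b L M N (fun r => r ^+ n)) => // [r r1|r r1].
  by rewrite exprn_ege1.
have symH : hess (poly_fun p) (polar r A) 1 0 = hess (poly_fun p) (polar r A) 0 1.
  by rewrite !hess_poly_fun mderiv_comm.
have := umbilic_ratio_bounds _ _ _ _ _ (hk (polar r A)) symH (hxi (polar r A)).
rewrite /= !hess_poly_fun !partial_poly_fun polarE -/u.
rewrite !(poly_fun_scale _ _ _ _ (hpi _)) !(poly_fun_scale _ _ _ _ (hpij _ _)).
rewrite -/a -/b -/L -/M -/N.
rewrite ![r ^+ n.+1]exprSr.
set h := r ^+ n.
have -> : h * L + h * N + ((h * r * b) ^+ 2 * (h * L)
     - 2 * (h * r * a) * (h * r * b) * (h * M) + (h * r * a) ^+ 2 * (h * N))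
   = h * (L + N) + (h * r) ^+ 2 * h * q by rewrite /q; ring.
have -> : h * L * (h * N) - (h * M) ^+ 2 = h ^+ 2 * D by rewrite /D; ring.
by [].
Qed.
End UmbilicDirections.

(** * Degrees 0 and 1, and the final count *)

Lemma power_of_linear_form_deg_le1 (R : realType) n (p : mpoly 2 R) :
  (n <= 1)%N -> p \is ishomog1 n mdeg -> power_of_linear_form n (poly_fun p).
Proof.
case: n => [|[|//]] _ hp.
  (* In degree 0 the power of the zero linear form is 0^0 = 1. *)
  exists (dehomogenize p)`_0, 0, 0 => x.
  by rewrite (poly_fun_dehomogenize 0) // big_ord1 !expr0 !mulr1.
exists 1, (dehomogenize p)`_1, (dehomogenize p)`_0 => x.
rewrite (poly_fun_dehomogenize 1) // !big_ord_recl big_ord0 /= /bump /=.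
by rewrite subn0 subnn !expr0 !expr1; ring.
Qed.

Theorem theorem1 (R : realType) (n : nat) (p : mpoly 2 R)
    (k1 k2 : 'rV[R]_2 -> R) (xi : 'rV[R]_2 -> R[i])
    (hp : p \is ishomog1 n mdeg)
    (hlin : ~ power_of_linear_form n (poly_fun p))
    (hk : forall x, principal_curvatures (poly_fun p) x (k1 x) (k2 x))
    (hxi : forall x, gauss_coordinate (poly_fun p) x (xi x)) :
  exists m : nat,
    [/\ [set A : R | 0 <= A < 2 * pi /\ umbilic_at_infinity k1 k2 xi A]
          #= `I_m,
        ~~ odd m & (m + 8 <= 6 * n)%N].
Proof.
case: n hp hlin => [|[|n]] hp hlin.
- by case: hlin; exact: power_of_linear_form_deg_le1.
- by case: hlin; exact: power_of_linear_form_deg_le1.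
have G0 : dehomogenize (p * hessian_mpoly p) != 0.
  by apply/eqP => /(power_of_linear_form_hessian0 n.+2 p isT hp)/hlin.
(* With m = n + 2 the degree of the form is 3 m - 4; doubling this bound on the directions in [0,
   pi) gives 6 m - 8. *)
have [s [us sB ss]] := @bounded_uniq_seq R
  [set A | 0 <= A < pi /\ umbilic_direction p A] (n.+2 + (n + n)) (fun s us sB =>
    binary_form_zeros _ _ _ (dhomog_hessian _ _ hp) G0 us
      (fun A As => let: conj hA hu := sB A As in conj hA hu.1)).
exists (2 * size s)%N; split; last 2 first.
- by rewrite mul2n odd_double.
- by lia.
have uE A := umbilic_directionP n p A k1 k2 xi hp hk hxi.
apply: card_antipodal => // A.
- by move=> hA; rewrite uE -sB /=; split=> [|[]].
- by move=> /sB[].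
- by rewrite !uE; exact: umbilic_directionDpi hp.
Qed.
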